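(* Let $C\ge 1$, let $\mathcal{S}_1,\dots,\mathcal{S}_C$ be Polish spaces, let $\mathbf{N}=(N_i)_{1\le i\le C}$ with integers $N_i\ge 1$, and let $(X^{\mathbf{N}}_{n,i})_{1\le n\le N_i,\,1\le i\le C}$ be a finite multi-exchangeable multi-class system, where $X^{\mathbf{N}}_{n,i}$ takes values in $\mathcal{S}_i$. Let $(\Lambda^{\mathbf{N}}_i)_{1\le i\le C}$ be its empirical measure vector. Then the conditional law of the system given the value of $(\Lambda^{\mathbf{N}}_i)_{1\le i\le C}$ corresponds to independent uniform orderings, for $1\le i\le C$, of the $N_i$ (possibly repeated) values of the particles of class $i$, which are the atoms of the value of $\Lambda^{\mathbf{N}}_i$ counted with their multiplicities. That is, almost surely, $$\mathcal{L}\Bigl(\bigl((X^{\mathbf{N}}_{1,i},\dots,X^{\mathbf{N}}_{N_i,i})\bigr)_{1\le i\le C}\,\Big|\,(\Lambda^{\mathbf{N}}_i)_{1\le i\le C}\Bigr)=\bigotimes_{i=1}^C U_{N_i}(\Lambda^{\mathbf{N}}_i),$$ where $U_{N_i}(\Lambda_i^{\mathbf{N}})$ is the law of a uniform ordering of the $N_i$ atoms of $\Lambda_i^{\mathbf{N}}$ counted with multiplicity.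
   Context: For $k\ge1$, $\Sigma(k)$ denotes the set of permutations of $\{1,\dots,k\}$. For a Polish space $\mathcal{S}$, $\mathcal{P}(\mathcal{S})$ is the space of Borel probability measures on $\mathcal{S}$ with the weak topology (and its Borel $\sigma$-algebra). $\mathcal{L}$ denotes the law of a random element, and $\mathcal{L}(\cdot\mid\cdot)$ a (regular) conditional law. A multi-class system $(X^{\mathbf{N}}_{n,i})_{1\le n\le N_i,\,1\le i\le C}$ consists of random variables defined on a common probability space, $X^{\mathbf{N}}_{n,i}$ (the $n$-th particle of class $i$) having values in $\mathcal{S}_i$. It is multi-exchangeable if $$\mathcal{L}\bigl((X^{\mathbf{N}}_{\sigma_i(n),i})_{1\le n\le N_i,\,1\le i\le C}\bigr)=\mathcal{L}\bigl((X^{\mathbf{N}}_{n,i})_{1\le n\le N_i,\,1\le i\le C}\bigr)\quad\text{for all }\sigma_i\in\Sigma(N_i),\ 1\le i\le C.$$ Its empirical measure vector is $(\Lambda^{\mathbf{N}}_i)_{1\le i\le C}$, with $$\Lambda^{\mathbf{N}}_i=\frac1{N_i}\sum_{n=1}^{N_i}\delta_{X^{\mathbf{N}}_{n,i}},$$ a random element of $\mathcal{P}(\mathcal{S}_1)\times\cdots\times\mathcal{P}(\mathcal{S}_C)$. For a measure of the form $\mu=\frac1N\sum_{n=1}^N\delta_{x_n}$ with $x_1,\dots,x_N\in\mathcal{S}$, the law of a uniform ordering of its $N$ atoms counted with multiplicity is $$U_N(\mu)=\frac1{N!}\sum_{\sigma\in\Sigma(N)}\delta_{(x_{\sigma(1)},\dots,x_{\sigma(N)})}\in\mathcal{P}(\mathcal{S}^N),$$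 which depends only on $\mu$ (and $N$), not on the chosen enumeration $x_1,\dots,x_N$. *)

(* Defs.v *)
From HB Require Import structures.
From mathcomp Require Import all_boot all_order all_algebra all_fingroup.
From mathcomp Require Import all_classical all_reals all_analysis giry.

Set Implicit Arguments.
Unset Strict Implicit.
Unset Printing Implicit Defensive.

Import Order.TTheory GRing.Theory Num.Theory.
Import numFieldNormedType.Exports.

Local Open Scope classical_set_scope.
Local Open Scope ring_scope.

Record complete_distance (R : realType) (T : topologicalType)
    (d : T -> T -> R) : Prop := {
  distance_ge0 : forall x y, 0 <= d x y ;
  distance_eq0 : forall x y, d x y = 0 <-> x = y ;
  distanceC : forall x y, d x y = d y x ;
  distance_triangle : forall x y z, d x z <= d x y + d y z ;
  distance_nbhs : forall x (A : set T),
    nbhs x A <-> exists2 e : R, 0 < e & [set y | d x y < e] `<=` A ;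
  distance_complete : forall u : nat -> T,
    (forall e : R, 0 < e -> exists n0 : nat, forall m n : nat,
       (n0 <= m)%N -> (n0 <= n)%N -> d (u m) (u n) < e) ->
    exists l : T, u @ \oo --> l
}.

Definition polish (R : realType) (T : topologicalType) : Prop :=
  (exists2 D : set T, countable D & dense D) /\
  (exists d : T -> T -> R, complete_distance d).

HB.instance Definition _ (I : Type) (T : I -> ptopologicalType) :=
  isPointed.Build (prod_topology T) (fun i => point).

Notation borel T := (g_sigma_algebraType (@open T)).

Section weak_topology.
Variables (R : realType) (S : ptopologicalType).

Definition bounded_continuous : Type :=
  {f : S -> R | continuous f /\ bounded_fun f}.

Definition integrals (mu : probability (borel S) R) :
    prod_topology (fun _ : bounded_continuous => R) :=
  fun f => \int[mu]_x (sval f x).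

(* Elements are set functions, so two of them stand for the same point of P(S)
   when they agree on Borel sets (measure_eq); the topology cannot separate
   such elements. *)
Definition prob_space : Type := initial_topology integrals.

HB.instance Definition _ := PointedTopological.on prob_space.

End weak_topology.
Arguments prob_space : clear implicits.

Section average_of_diracs.
Local Open Scope ereal_scope.
Context d (T : measurableType d) (R : realType) (I : finType).
Variables (I0 : (0 < #|I|)%N) (x : I -> T).

(* The unused proof that I is nonempty lets the instance below be a probability. *)
Definition dirac_average (_ : (0 < #|I|)%N) (y : I -> T) : set T -> \bar R :=
  fun A => (#|I|%:R^-1)%:E * \sum_(i : I) \d_(y i) A.

Let average0 : dirac_average I0 x set0 = 0.
Proof. by rewrite /dirac_average big1 ?mule0// => i _; rewrite measure0. Qed.

Let average_ge0 A : 0 <= dirac_average I0 x A.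
Proof.
rewrite /dirac_average mule_ge0 ?lee_fin ?invr_ge0//.
by apply: sume_ge0 => i _; exact: measure_ge0.
Qed.

Let average_sigma_additive : semi_sigma_additive (dirac_average I0 x).
Proof.
move=> F mF tF mUF; rewrite /dirac_average.
rewrite [X in X @ _ --> _](_ : _ = (fun n => (#|I|%:R^-1)%:E *
    \sum_(i : I) \sum_(0 <= k < n) \d_(x i) (F k))); last first.
  apply/funext => n; rewrite exchange_big/= ge0_sume_distrr// => k _.
  by apply: sume_ge0 => i _; exact: measure_ge0.
apply: cvgeZl => //; apply: cvg_nnesum.
  by move=> i _; near=> n; apply: sume_ge0 => k _; exact: measure_ge0.
by move=> i _; exact: measure_semi_sigma_additive.
Unshelve. all: by end_near. Qed.

HB.instance Definition _ := isMeasure.Build _ _ _ (dirac_average I0 x)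
  average0 average_ge0 average_sigma_additive.

Let average_setT : dirac_average I0 x [set: T] = 1.
Proof.
rewrite /dirac_average (eq_bigr (fun=> 1)); last by move=> i _; rewrite diracT.
rewrite sumEFin sumr_const -EFinM mulVf// pnatr_eq0 -lt0n.
exact: I0.
Qed.

HB.instance Definition _ :=
  Measure_isProbability.Build _ _ _ (dirac_average I0 x) average_setT.

End average_of_diracs.

Definition empirical_measure (R : realType) (S : ptopologicalType) (N : nat)
    (N0 : (0 < N)%N) (x : 'I_N -> S) : probability (borel S) R :=
  @dirac_average _ (borel S) R _ (etrans (congr1 (leq 1) (card_ord N)) N0) x.

Lemma card_perm_gt0 (N : nat) : (0 < #|{perm 'I_N}|)%N.
Proof. by apply/card_gt0P; exists 1%g. Qed.

Definition permuted_law (R : realType) (S : ptopologicalType) (N : nat)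
    (x : 'I_N -> S) :
    probability (borel (prod_topology (fun _ : 'I_N => S))) R :=
  @dirac_average _ (borel (prod_topology (fun _ : 'I_N => S))) R _
    (card_perm_gt0 N) (fun (s : {perm 'I_N}) (n : 'I_N) => x (s n)).

(* The enumeration x of the atoms of mu is chosen arbitrarily; the lemma below
   shows that the choice is immaterial. When mu is not an average of N Dirac
   masses the value is a dummy. *)
Definition uniform_ordering (R : realType) (S : ptopologicalType) (N : nat)
    (N0 : (0 < N)%N) (mu : probability (borel S) R) :
    probability (borel (prod_topology (fun _ : 'I_N => S))) R :=
  permuted_law R
    (xget (fun _ => point) [set x | mu ≡μ empirical_measure R N0 x]).

Lemma borel_set1 (S : ptopologicalType) (p : S) :
  hausdorff_space S -> measurable ([set p] : set (borel S)).
Proof.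
move=> hS; rewrite -[X in measurable X]setCK; apply: measurableC.
apply: sub_sigma_algebra; rewrite openC.
exact/accessible_closed_set1/hausdorff_accessible.
Qed.

Lemma empirical_measure_perm (R : realType) (S : ptopologicalType) (N : nat)
    (N0 : (0 < N)%N) (x y : 'I_N -> S) : hausdorff_space S ->
  empirical_measure R N0 x ≡μ empirical_measure R N0 y ->
  exists s : {perm 'I_N}, forall n, x n = y (s n).
Proof.
move=> hS xy.
have mass1 (z : 'I_N -> S) (p : S) :
    (\sum_(i : 'I_N) @dirac _ (borel S) (z i) R [set p] =
     (count_mem p (mktuple z))%:R%:E)%E.
  under eq_bigr do rewrite diracE.
  rewrite sumEFin -natr_sum; congr (_%:R%:E).
  rewrite count_map -sum1_count big_enum_cond/= [RHS]big_mkcond/=.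
  by apply: eq_bigr => i _; rewrite in_set1; case: eqP.
have : perm_eq (mktuple x) (mktuple y).
  apply/allP => p _ /=; apply/eqP.
  have := xy _ (borel_set1 p hS).
  rewrite /empirical_measure/= /dirac_average !mass1 -!EFinM => -[] /eqP.
  rewrite (inj_eq (mulfI _)) ?invr_eq0 ?pnatr_eq0 ?card_ord -?lt0n//.
  by rewrite eqr_nat => /eqP.
move=> /tuple_permP[s xs]; exists s => n.
have := congr1 (fun t => nth (x n) t n) xs.
by rewrite !nth_mktuple tnth_mktuple.
Qed.

Lemma permuted_law_perm (R : realType) (S : ptopologicalType) (N : nat)
    (x y : 'I_N -> S) (s : {perm 'I_N}) : (forall n, x n = y (s n)) ->
  permuted_law R x ≡μ permuted_law R y.
Proof.
move=> xy A mA; rewrite /permuted_law/= /dirac_average; congr (_ * _)%E.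
rewrite [RHS](reindex_inj (mulIg s))/=; apply: eq_bigr => t _.
suff -> : (fun n => x (t n)) = (fun n => y ((t * s)%g n)) by [].
by apply/funext => n; rewrite xy permM.
Qed.

Lemma uniform_ordering_empirical_measure (R : realType) (S : ptopologicalType)
    (N : nat) (N0 : (0 < N)%N) (mu : probability (borel S) R) (x : 'I_N -> S) :
  hausdorff_space S -> mu ≡μ empirical_measure R N0 x ->
  uniform_ordering N0 mu ≡μ permuted_law R x.
Proof.
move=> hS mux; rewrite /uniform_ordering; case: xgetP => [y _ muy|/(_ x)//].
have [A mA|s /permuted_law_perm] := @empirical_measure_perm R S N N0 y x hS.
  by rewrite -muy// mux.
exact.
Qed.

(* The tensor product of the mu i, characterised by its values on boxes; on
   second countable spaces the boxes form a pi-system generating the Borel sets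
   of the product topology, so at most one law qualifies. *)
Definition is_product_law (R : realType) (I : finType)
    (T : I -> ptopologicalType) (mu : forall i, probability (borel (T i)) R)
    (Q : {measure set (borel (prod_topology T)) -> \bar R}) : Prop :=
  forall A : forall i, set (borel (T i)), (forall i, measurable (A i)) ->
    Q [set z : prod_topology T | forall i, A i (z i)] =
    (\prod_(i : I) mu i (A i))%E.

(* Law of Y given Z: a kernel from the sigma-algebra generated by Z is a
   random probability measure that is measurable with respect to Z. *)
Definition regular_cond_law d d1 d2 (Omega : measurableType d)
    (E : measurableType d1) (F : measurableType d2) (R : realType)
    (P : probability Omega R) (Y : Omega -> E) (Z : Omega -> F)
    (K : R.-pker (g_sigma_algebra_preimageType Z) ~> E) : Prop :=
  forall (A : set E) (B : set F), measurable A -> measurable B ->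
    (\int[P]_(w in Z @^-1` B) K w A)%E = P (Y @^-1` A `&` Z @^-1` B).

Section multiclass.
Variables (R : realType) (C : nat) (S : 'I_C -> ptopologicalType).
Variable N : 'I_C -> nat.

Definition configuration : ptopologicalType :=
  prod_topology (fun i : 'I_C =>
    prod_topology (fun _ : 'I_(N i) => S i) : ptopologicalType).

Variables (d : measure_display) (Omega : measurableType d).
Variable P : probability Omega R.
Variable X : forall i : 'I_C, 'I_(N i) -> {RV P >-> borel (S i)}.

Definition system (w : Omega) : borel configuration := fun i n => X n w.

Definition multi_exchangeable : Prop :=
  forall s : forall i : 'I_C, {perm 'I_(N i)},
  forall A : set (borel configuration), measurable A ->
    pushforward P (fun w => (fun i n => X (s i n) w) : borel configuration) A =
    pushforward P system A.

Definition empirical_vector (N0 : forall i, (0 < N i)%N) (w : Omega) :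
    borel (prod_topology (fun i : 'I_C => prob_space R (S i) : ptopologicalType)) :=
  fun i => empirical_measure R (N0 i) (fun n => X n w).

End multiclass.

(* Main.v *)
Require Import Defs.
From HB Require Import structures.
From mathcomp Require Import all_boot all_order all_algebra all_fingroup.
From mathcomp Require Import all_classical all_reals all_analysis.
From mathcomp Require Import measurable_realfun lra.

(** Write Z for the empirical measure vector, G for the finite group of tuples
    of permutations (one for each class), and let [shuffled_law x] be the
    average of the Dirac masses at the configurations obtained from x by
    the elements of G. The kernel w |-> [shuffled_law (system X w)] is the
    conditional law of the system given Z, for two reasons.

    It integrates correctly: Z is a function of the system which permuting
    particles inside classes leaves unchanged, so exchangeability says that, for
    every s in G, the event that the s-shuffled system lies in A while Z lies
    in B has the same probability as the event that the system lies in A while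
    Z lies in B ([shuffle_exchangeable]). Averaging over s gives the identity
    defining a conditional law ([shuffled_law_conditional]).

    It is measurable with respect to Z, which is the substantial point. By a
    pi-lambda argument it is enough to look at the mass given to a product of
    sets, and this mass is a product over the classes, because a uniform element
    of G has independent uniform components ([shuffled_law_box]). For one class
    and a product of Borel sets A_1, ..., A_N, the mass depends only on the
    numbers of particles falling in each cell of the partition generated by the
    A_n: two configurations with the same numbers differ by a permutation as far
    as the A_n can tell ([measurable_permuted_law_box]). Divided by N, these
    numbers are values of the empirical measure, and mu |-> mu A is a Borel
    function for the weak topology ([measurable_evaluation]): the mass of a cozero set
    {g > 0} is the limit of the integrals of the continuous functions
    min(1, k g), and countably many cozero sets form a pi-system generating the
    Borel sets ([polish_pi_base]).

    Finally, two conditional laws agree almost surely on each Borel set, hence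
    simultaneously on a countable generating pi-system, hence everywhere
    ([regular_cond_law_ae_eq]); so any conditional law is almost surely the
    shuffled law, that is, the product of the uniform orderings.

    Two remarks on measurability in product spaces. Countable pi-systems of open
    boxes generate the Borel sets of the space of configurations, so the system
    is a random element of it. The empirical measure vector is then a random
    element because it is a continuous function of the configuration
    ([config_empirical_continuous]). *)

Set Implicit Arguments.
Unset Strict Implicit.
Unset Printing Implicit Defensive.

Import Order.TTheory GRing.Theory Num.Theory.
Import numFieldNormedType.Exports.

Local Open Scope classical_set_scope.
Local Open Scope ring_scope.

(** * Countable pi-systems of open sets *)

(** A countable base which is also a pi-system: being a base, it generates the
    Borel sets; being a pi-system containing the whole space, it determines
    probability measures. *)
Definition pi_base (T : topologicalType) (B : set (set T)) : Prop :=
  [/\ countable B, B setT, setI_closed B & basis B].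

Lemma countable_enumeration (T : choiceType) (B : set T) :
  countable B -> B !=set0 -> exists e : nat -> T, B = range e.
Proof.
move=> /countable_injP[f f_inj] [b Bb].
exists (fun n => xget b [set x | B x /\ f x = n]); apply/seteqP; split => [x Bx|].
  exists (f x) => //; case: xgetP => [y _ [By fyx]|/(_ x)/not_andP[]//].
  by apply: f_inj; rewrite ?inE.
by move=> _ [n _ <-]; case: xgetP => // y _ [].
Qed.

Section pi_base_theory.
Variables (T : topologicalType) (B : set (set T)).
Hypothesis baseB : pi_base B.

Lemma pi_base_open : B `<=` open.
Proof. by case: baseB => _ _ _ []. Qed.

Lemma open_bigcup_pi_base (U : set T) : open U ->
  U = \bigcup_(V in [set V | B V /\ V `<=` U]) V.
Proof.
have [_ _ _ [_ nbhsB]] := baseB; rewrite openE => oU.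
apply/seteqP; split => [x Ux|x [V [_ VU]] /VU//].
by have [V [BV Vx] VU] := nbhsB x U (oU x Ux); exists V.
Qed.

End pi_base_theory.

(** An open set is the union of the base sets it contains, a countable union. *)
Lemma borel_pi_base (T : ptopologicalType) (B : set (set T)) : pi_base B ->
  @measurable _ (borel T) = <<s B >>.
Proof.
move=> baseB; have [cB BT BI _] := baseB.
apply/seteqP; split; last first.
  apply: smallest_sub; first exact: sigma_algebra_measurable.
  by move=> U BU; apply: sub_sigma_algebra; exact: pi_base_open BU.
suff : <<s @open T >> `<=` <<s B >> by [].
apply: smallest_sub; first exact: smallest_sigma_algebra.
move=> U /(open_bigcup_pi_base baseB) ->.
have [e Be] := countable_enumeration cB (ex_intro _ _ BT).
(* the union is taken along an enumeration of the whole base, with the empty set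
   standing for the base sets that are not contained in U *)
rewrite (_ : \bigcup_(V in _) V =
    \bigcup_n (if `[< e n `<=` U >] then e n else set0)).
  apply: sigma_algebra_bigcup => n; case: asboolP => _.
    by apply: sub_sigma_algebra; rewrite Be; exists n.
  exact: sigma_algebra0.
apply/seteqP; split => [x [V [BV VU] Vx]|x [n _]].
  move: BV; rewrite Be => -[n _ en]; exists n => //.
  by rewrite en; case: asboolP.
case: asboolP => // eU ex; exists (e n) => //.
by split => //; rewrite Be; exists n.
Qed.

Lemma borel_open (T : ptopologicalType) (U : set T) :
  open U -> measurable (U : set (borel T)).
Proof. exact: sub_sigma_algebra. Qed.

Lemma continuous_borel (T U : ptopologicalType) (f : T -> U) : continuous f ->
  measurable_fun [set: borel T] (f : borel T -> borel U).
Proof.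
move=> /continuousP cf.
apply: (@measurability _ _ (borel T) (borel U) setT f (@open U)) => //.
by move=> _ [A oA <-]; rewrite setTI; apply: sub_sigma_algebra; exact: cf.
Qed.

Section boxes.
Context (I : finType) (T : I -> ptopologicalType).

Definition box (A : forall i, set (T i)) : set (prod_topology T) :=
  [set z | forall i, A i (z i)].

Definition boxes (B : forall i, set (set (T i))) : set (set (prod_topology T)) :=
  [set box A | A in [set A | forall i, B i (A i)]].

Lemma coordinate_continuous (i : I) : continuous (fun z : prod_topology T => z i).
Proof. exact: (@proj_continuous I T i). Qed.

Lemma box_measurable (A : forall i, set (borel (T i))) :
  (forall i, measurable (A i)) ->
  measurable (box A : set (borel (prod_topology T))).
Proof.
move=> mA; rewrite (_ : box A = \bigcap_i ((fun z => z i) @^-1` A i)); last first.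
  by apply/seteqP; split => z /= Az i => [_|]; exact: Az.
apply: fin_bigcap_measurable => // i _.
rewrite -[X in measurable X]setTI.
by apply: continuous_borel => //; exact: coordinate_continuous.
Qed.

Lemma box_open (A : forall i, set (T i)) : (forall i, open (A i)) -> open (box A).
Proof.
move=> oA; rewrite openE => z Az; rewrite /interior.
apply: (filter_forall (nbhs_filter z)) => i.
by apply: coordinate_continuous; exact: open_nbhs_nbhs.
Qed.

(** The finiteness of I makes boxes of open sets open and the family of boxes
    countable. The statement can be iterated, which is how it serves for
    configurations, products of products. *)
Lemma pi_base_boxes (B : forall i, set (set (T i))) :
  (forall i, pi_base (B i)) -> pi_base (boxes B).
Proof.
move=> baseB; split.
- have code i : {f : set (T i) -> nat | {in B i &, injective f}}.
    by apply/cid/countable_injP; case: (baseB i).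
  pose f i := sval (code i); pose f_inj i := svalP (code i).
  apply: (sub_countable (card_image_le _ _)).
  apply/countable_injP.
  exists (fun A => choice.pickle [ffun i => f i (A i)]) => A A'.
  rewrite !inE => BA BA' /(pcan_inj choice.pickleK)/ffunP fA.
  apply/functional_extensionality_dep => i.
  by apply: f_inj; rewrite ?inE//; have := fA i; rewrite !ffunE.
- exists (fun=> setT) => [i|]; first by case: (baseB i).
  by apply/seteqP; split.
- move=> _ _ [A BA <-] [A' BA' <-]; exists (fun i => A i `&` A' i) => [i|].
    by case: (baseB i) => _ _ BI _; exact: BI.
  by apply/seteqP; split => [z Az|z [] Az A'z i]; [split => i; have [] := Az i|].
- split=> [_ [A BA <-]|x].
    by apply: box_open => i; exact/(pi_base_open (baseB i))/BA.
  have FF : Filter (filter_from [set U | boxes B U /\ U x] id).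
    apply: filter_from_filter.
      exists setT; split => //; exists (fun=> setT); last by apply/seteqP; split.
      by move=> i; case: (baseB i).
    move=> _ _ [[A BA <-] Ax] [[A' BA' <-] A'x].
    exists (box (fun i => A i `&` A' i)); last first.
      by move=> z Az; split => i; have [] := Az i.
    split=> [|i]; last by split.
    exists (fun i => A i `&` A' i) => // i.
    by case: (baseB i) => _ _ BI _; exact: BI.
  apply/cvg_sup => i U; rewrite nbhsE => -[_ [[V oV <-] Vx] VU].
  have [_ _ _ [_ nbhsB]] := baseB i.
  have [W [BW Wx] WV] := nbhsB (x i) V (open_nbhs_nbhs (conj oV Vx)).
  exists (box (dfwith (fun=> setT) i W)) => /=; last first.
    by move=> z /(_ i); rewrite dfwithin => /WV Vz; exact: VU.
  split.
    exists (dfwith (fun=> setT) i W) => //= j.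
    by case: dfwithP => [//|k _]; case: (baseB k).
  by move=> j; case: dfwithP.
Qed.

End boxes.

(** * Cozero sets of a Polish space *)

Definition cozero (R : realType) (T : topologicalType) (U : set T) : Prop :=
  exists g : T -> R,
    [/\ continuous g, forall x, 0 <= g x & U = [set x | 0 < g x]].
Arguments cozero R {T} U.

Section complete_distance_theory.
Variables (R : realType) (T : ptopologicalType) (d : T -> T -> R).
Hypothesis dist : complete_distance d.

(** Positive exactly on the open ball of centre x and radius r. *)
Definition tent (x : T) (r : R) (y : T) : R := Num.max 0 (r - d x y).

Lemma tent_continuous x r : continuous (tent x r).
Proof.
move=> y; apply: (@continuous_comp _ _ _ (d x) (fun t => Num.max 0 (r - t))).
  apply/cvgrPdist_lt => e e0; apply/(distance_nbhs dist); exists e => // z /= yz.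
  rewrite (le_lt_trans _ yz)// ler_norml; apply/andP; split.
    by have := distance_triangle dist x y z; lra.
  have := distance_triangle dist x z y; rewrite (distanceC dist z y); lra.
apply: continuous_max; first exact: cvg_cst.
by apply: cvgB; [exact: cvg_cst|exact: cvg_id].
Qed.

Lemma cozero_ball x (r : R) : cozero R [set y | d x y < r].
Proof.
exists (tent x r); split; first exact: tent_continuous.
  by move=> y; rewrite /tent le_max lexx.
by apply/seteqP; split => y /=; rewrite /tent lt_max ltxx/= subr_gt0.
Qed.

Lemma distance_hausdorff : hausdorff_space T.
Proof.
rewrite open_hausdorff => x y xy.
have dxy : 0 < d x y.
  rewrite lt_neqAle (distance_ge0 dist) andbT eq_sym; apply: contra xy => /eqP.
  by move=> /(distance_eq0 dist) ->.
have oball z : open [set t | d z t < d x y / 2].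
  rewrite openE => t /= zt; apply/(distance_nbhs dist).
  exists (d x y / 2 - d z t); first by rewrite subr_gt0.
  move=> s /= ts; have := distance_triangle dist z t s; lra.
have dd z : d z z = 0 by apply/(distance_eq0 dist).
exists ([set t | d x t < d x y / 2], [set t | d y t < d x y / 2]) => /=.
  by rewrite !inE/= !dd divr_gt0.
split => //; apply/eqP/seteqP; split => // t /= [xt yt].
by have := distance_triangle dist x t y; rewrite (distanceC dist t y); lra.
Qed.

End complete_distance_theory.

Section cozero_theory.
Variables (R : realType) (T : topologicalType).

Lemma cozero_open (U : set T) : cozero R U -> open U.
Proof.
move=> [g [cg _ ->]]; apply: (@open_comp _ _ g [set x | 0 < x]).
  by move=> x _; exact: cg.
exact: open_gt.
Qed.

Lemma cozeroT : cozero R [set: T].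
Proof.
exists (fun=> 1); split; [exact: cst_continuous|by []|].
by apply/seteqP; split => x //= _; exact: ltr01.
Qed.

Lemma cozeroI (U V : set T) : cozero R U -> cozero R V -> cozero R (U `&` V).
Proof.
move=> [g [cg g0 ->]] [h [ch h0 ->]]; exists (g \* h); split.
- by move=> x; apply: cvgM; [exact: cg|exact: ch].
- by move=> x /=; rewrite mulr_ge0.
- apply/seteqP; split => x /=; first by move=> [? ?]; exact: mulr_gt0.
  rewrite lt0r mulf_eq0 negb_or => /andP[/andP[gx hx] _].
  by split; rewrite lt0r ?gx ?hx /= ?g0 ?h0.
Qed.

End cozero_theory.

Lemma polish_hausdorff (R : realType) (T : ptopologicalType) :
  polish R T -> hausdorff_space T.
Proof. by move=> [_ [d dist]]; exact: distance_hausdorff dist. Qed.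

(** The base consists of the finite intersections of balls of radius 1/(n+1)
    around the points of a countable dense set; a product of functions cutting
    out balls cuts out their intersection. *)
Lemma polish_pi_base (R : realType) (T : ptopologicalType) : polish R T ->
  exists2 B : set (set T), pi_base B & B `<=` cozero R.
Proof.
move=> [[D cD dD] [d dist]].
pose ball (p : T * nat) := [set y | d p.1 y < p.2.+1%:R^-1].
pose I := D `*` [set: nat].
have ball_cozero p : cozero R (ball p).
  exact: cozero_ball.
have BC : finI_from I ball `<=` cozero R.
  move=> _ [J _ <-]; rewrite -bigsetI_fset_set// set_fsetK.
  elim/big_ind : _ => //; [exact: cozeroT|exact: cozeroI].
exists (finI_from I ball) => //; split.
- apply: finI_from_countable; apply: (countableX cD); exact: countableP.
- by exists finmap.fset0 => //; rewrite set_fset0 bigcap_set0.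
- by move=> A B; exact: finI_fromI.
- split=> [U /BC/cozero_open//|x A /(distance_nbhs dist)[e e0 eA]].
  have e20 : 0 < e / 2 by rewrite divr_gt0.
  have [n _ /(_ n (leqnn n)) ne] := near_infty_natSinv_lt (PosNum e20).
  have [y [xy Dy]] : (ball (x, n)) `&` D !=set0.
    apply: dD; last exact/cozero_open/ball_cozero.
    by exists x; rewrite /ball/= (_ : d x x = 0)//; apply/(distance_eq0 dist).
  (* as 2/(n+1) < e, the triangle inequality places this ball inside A *)
  exists (ball (y, n)); last first.
    move=> z yz; apply: eA; move: xy yz; rewrite /ball/= => xy yz.
    apply: (le_lt_trans (distance_triangle dist x y z)).
    by rewrite (splitr e) ltrD// ?(lt_trans xy)// (lt_trans yz).
  split; last by move: xy; rewrite /ball/= (distanceC dist).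
  by apply: finI_from1.
Qed.

(** * Averages of Dirac masses *)

(** Distributivity of products over sums whose index types depend on the factor:
    expanding the product amounts to choosing one index for each factor. *)
Lemma prod_sum_fprod (R : comPzSemiRingType) (I : finType) (T : I -> finType)
    (F : forall i, T i -> R) :
  \prod_i \sum_(j : T i) F i j = \sum_(t : fprod T) \prod_i F i (t i).
Proof.
under eq_bigr do rewrite big_tag; rewrite bigA_distr_big_dep.
have := @big_fprod R 0 1 *%R +%R I T (fun i => [ffun j => F i j]).
move=> /= distr.
transitivity (\sum_(t : fprod T) \prod_(i in I) [ffun j => F i j] (t i));
  last first.
  by apply: eq_bigr => t _; apply: eq_bigr => i _; rewrite ffunE.
rewrite distr; apply: eq_bigr => g _; apply: eq_bigr => i _.
by congr untag; apply: functional_extensionality_dep => j; rewrite ffunE.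
Qed.

(** Points of the space of probability measures are bundled measures, so the
    invariance of the empirical measure vector under shuffling needs an equality
    of bundles. *)
Lemma eq_probability d (T : measurableType d) (R : realType)
    (m1 m2 : probability T R) :
  (forall A, m1 A = m2 A) -> m1 = m2.
Proof.
case: m1 m2 => [m1 c1] [m2 c2] /= m12.
have e : m1 = m2 by apply: funext.
rewrite -{}e in c2 m12 *; congr Probability.Pack.
case: c1 c2 => a1 a2 a3 a4 a5 a6 a7 [b1 b2 b3 b4 b5 b6 b7].
(* the fields of the mixins are proofs, identified mixin by mixin *)
move: a1 b1 a2 b2 => [p1 q1] [p2 q2].
rewrite (Prop_irrelevance p2 p1) (Prop_irrelevance q2 q1).
move=> [p2'] [q2']; rewrite (Prop_irrelevance q2' p2').
move: a3 b3 a4 b4 => [p3] [q3] [p4] [q4].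
rewrite (Prop_irrelevance q3 p3) (Prop_irrelevance q4 p4).
move: a5 b5 a6 b6 a7 b7 => [p5] [q5] [p6] [q6] [p7] [q7].
rewrite (Prop_irrelevance q5 p5).
by rewrite (Prop_irrelevance q6 p6) (Prop_irrelevance q7 p7).
Qed.

Section integral_dirac_average.
Context d (T : measurableType d) (R : realType) (I : finType).
Variables (I0 : (0 < #|I|)%N) (x : I -> T).

Lemma dirac_averageE (A : set T) :
  dirac_average R I0 x A = (#|I|%:R^-1 * \sum_i (x i \in A)%:R)%:E.
Proof.
by rewrite /dirac_average; under eq_bigr do rewrite diracE; rewrite sumEFin.
Qed.

Lemma ge0_integral_dirac_average (f : T -> R) :
  measurable_fun [set: T] f -> (forall t, 0 <= f t) ->
  (\int[dirac_average R I0 x]_t (f t)%:E =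
   (#|I|%:R^-1 * \sum_i f (x i))%:E)%E.
Proof.
move=> mf f0; have [i0 _] := card_gt0P I0.
have c0 : 0 <= (#|I|%:R^-1 : R) by rewrite invr_ge0.
(* finite sums of measures are indexed by natural numbers, here the ranks in the
   enumeration of I *)
pose y k := x (nth i0 (enum I) k).
pose m : {measure set T -> \bar R} :=
  mscale (NngNum c0) (msum (fun k => \d_(y k)) #|I|).
have sumE (V : nmodType) (h : T -> V) : \sum_(k < #|I|) h (y k) = \sum_i h (x i).
  by rewrite -[RHS]big_enum (big_nth i0) big_mkord -cardE.
rewrite (@eq_measure_integral _ _ _ _ m); last first.
  move=> A mA _; rewrite /dirac_average /m/= /mscale/= /msum/=.
  by rewrite (sumE _ (fun t => \d_t A)).
have mEf : measurable_fun [set: T] (fun t => (f t)%:E) by exact/measurable_EFinP.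
have Ef0 t : [set: T] t -> (0 <= (f t)%:E)%E by rewrite lee_fin.
rewrite /m ge0_integral_mscale// ge0_integral_measure_sum//=.
under eq_bigr do rewrite integral_dirac// diracT mul1e.
by rewrite (sumE _ (fun t => (f t)%:E)) sumEFin -EFinM.
Qed.

Lemma Rintegral_dirac_average (f : T -> R) : measurable_fun [set: T] f ->
  \int[dirac_average R I0 x]_t f t = #|I|%:R^-1 * \sum_i f (x i).
Proof.
move=> mf; rewrite /Rintegral integralE funerpos funerneg.
rewrite !ge0_integral_dirac_average//;
  [|exact: measurable_funrneg|exact: measurable_funrpos].
rewrite -EFinB/= -mulrBr -sumrB; congr (_ * _); apply: eq_bigr => i _.
by rewrite -[in RHS](funrposBneg f).
Qed.

End integral_dirac_average.

(** * Evaluating a random probability measure on a Borel set *)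

(** The sets on which the mass is measurable form a lambda-system, by additivity
    and passage to the limit. *)
Lemma measurable_probability_pi_system d d' (W : measurableType d)
    (T : measurableType d') (R : realType) (G : set (set T))
    (m : W -> probability T R) :
  @measurable _ T = <<s G >> -> setI_closed G ->
  (forall A, G A -> measurable_fun [set: W] (fun w => m w A)) ->
  forall A, measurable A -> measurable_fun [set: W] (fun w => m w A).
Proof.
move=> mG GI Gm A mA.
apply: (@dynkin_induction _ T G
  (fun A => measurable_fun [set: W] (fun w => m w A))); rewrite -?mG//.
- by under eq_fun do rewrite probability_setT; exact: measurable_cst.
- move=> U mU mmU; under eq_fun do rewrite probability_setC//.
  exact: emeasurable_funB.
- move=> F mF tF mmF.
  apply: (emeasurable_fun_cvg (fun n w => \sum_(0 <= i < n) m w (F i))%E).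
    by move=> n; exact: emeasurable_sum.
  move=> w _; apply: measure_semi_sigma_additive => //.
  exact: bigcupT_measurable.
Qed.

Section evaluation.
Variables (R : realType) (S : ptopologicalType).

Lemma continuous_measurable_realfun (f : S -> R) :
  continuous f -> measurable_fun [set: borel S] (f : borel S -> R).
Proof.
move=> /continuousP cf; apply: (measurability _ (RGenOpens.measurableE R)).
move=> _ [_ [a [b ->]] <-]; rewrite setTI; apply: sub_sigma_algebra.
by apply: cf; exact: interval_open.
Qed.

(** The weak topology is the coarsest making these integrals continuous; their
    continuity gives their measurability. *)
Lemma measurable_integral_prob_space (f : S -> R) :
  continuous f -> (forall x, 0 <= f x <= 1) ->
  measurable_fun [set: borel (prob_space R S)]
    (fun mu : borel (prob_space R S) =>
       (\int[mu : probability (borel S) R]_x (f x)%:E)%E).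
Proof.
move=> cf f01.
have bf : bounded_fun f.
  exists 1; split => // M M1 x _; have /andP[f0 f1] := f01 x.
  by rewrite /= ger0_norm// (le_trans f1)// ltW.
pose bc : bounded_continuous R S := exist _ f (conj cf bf).
have mbc : measurable_fun [set: borel (prob_space R S)]
    (fun mu : borel (prob_space R S) => integrals mu bc).
  apply: (measurability _ (RGenOpens.measurableE R)).
  move=> _ [_ [a [b ->]] <-]; rewrite setTI; apply: sub_sigma_algebra.
  apply: (@open_comp _ _ _ `]a, b[%classic); last exact: interval_open.
  move=> mu _.
  apply: (@continuous_comp _ _ _ (@integrals R S : prob_space R S -> _)
    (fun z => z bc)); first exact: initial_continuous.
  exact: (@proj_continuous {classic (bounded_continuous R S)} (fun=> R) bc).
have -> : (fun mu : borel (prob_space R S) =>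
    (\int[mu : probability (borel S) R]_x (f x)%:E)%E) =
    EFin \o (fun mu => integrals mu bc).
  apply/funext => mu /=; rewrite /integrals /Rintegral fineK//.
  apply: integrable_fin_num => //.
  apply: measurable_bounded_integrable => //.
    by rewrite (le_lt_trans (probability_le1 _ _))// ltry.
  exact: continuous_measurable_realfun.
exact/measurable_EFinP.
Qed.

(** The functions min(1, n g) are continuous and increase to the indicator of
    {g > 0}. *)
Lemma measurable_prob_space_cozero (U : set S) : cozero R U ->
  measurable_fun [set: borel (prob_space R S)]
    (fun mu : borel (prob_space R S) => (mu : probability (borel S) R) U).
Proof.
move=> cU; have oU := cozero_open cU; have mU := borel_open oU.
case: cU => g [cg g0 Ug].
pose f n x : R := Num.min 1 (n%:R * g x).
have f0 n x : 0 <= f n x.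
  by rewrite le_min ler01 mulr_ge0.
have f1 n x : f n x <= 1 by rewrite ge_min lexx.
have cf n : continuous (f n).
  move=> x; apply: (@continuous_min R S (fun=> 1) (fun y => n%:R * g y)).
    exact: cvg_cst.
  by apply: cvgM; [exact: cvg_cst|exact: cg].
apply: (emeasurable_fun_cvg (fun n (mu : borel (prob_space R S)) =>
    (\int[mu : probability (borel S) R]_x (f n x)%:E)%E)).
  by move=> n; apply: measurable_integral_prob_space => // x; rewrite f0 f1.
move=> mu _; rewrite -[in X in _ --> X](setIT U) -integral_indic//.
have fU x : (f n x)%:E @[n --> \oo] --> (\1_U x)%:E.
  apply/cvg_EFin; first exact: nearW.
  rewrite /comp/= indicE.
  have [Ux|Ux] := pselect (U x).
    have gx : 0 < g x by move: Ux; rewrite Ug.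
    rewrite mem_set//; apply: cvg_near_cst.
    near=> n; rewrite /f; apply/min_idPl.
    rewrite -ler_pdivrMr// mul1r.
    by near: n; exact: nbhs_infty_ger.
  have gx : g x = 0.
    by apply/eqP; rewrite eq_le g0 andbT leNgt; apply/negP; move: Ux; rewrite Ug.
  rewrite memNset//; apply: cvg_near_cst; near=> n.
  by rewrite /f gx mulr0; apply/min_idPr; exact: ler01.
have -> : (\int[mu : probability (borel S) R]_x (\1_U x)%:E =
    \int[mu : probability (borel S) R]_x limn (fun n => (f n x)%:E))%E.
  by apply: eq_integral => x _; apply/esym/cvg_lim => //; exact: fU.
apply: cvg_monotone_convergence => //.
- by move=> n; apply/measurable_EFinP; exact: continuous_measurable_realfun.
- by move=> n x _; rewrite lee_fin.
- move=> x _ n m nm; rewrite lee_fin /f le_min ge_min lexx/= ge_min.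
  by rewrite ler_wpM2r ?ler_nat ?orbT.
Unshelve. all: by end_near. Qed.

Lemma measurable_evaluation (A : set (borel S)) : polish R S -> measurable A ->
  measurable_fun [set: borel (prob_space R S)]
    (fun mu : borel (prob_space R S) => (mu : probability (borel S) R) A).
Proof.
move=> /polish_pi_base[B baseB Bcozero].
have [_ _ BI _] := baseB.
apply: (@measurable_probability_pi_system _ _ _ (borel S) R B).
- exact: borel_pi_base.
- exact: BI.
- by move=> U BU; apply: measurable_prob_space_cozero; exact: Bcozero.
Qed.

End evaluation.

(** * The empirical measure determines the law of a uniform ordering *)

(** The preimage of any B is a union of fibers of c, and there are only countably
    many fibers. *)
Lemma measurable_preimage_determined d (W : measurableType d) (K : countType)
    (Y : Type) (c : W -> K) (f : W -> Y) :
  (forall k, measurable (c @^-1` [set k])) ->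
  (forall w w', c w = c w' -> f w = f w') ->
  forall B, measurable (f @^-1` B).
Proof.
move=> mc cf B.
rewrite (_ : _ @^-1` _ = \bigcup_(k in [set: K])
    (if `[< exists2 w, c w = k & B (f w) >] then c @^-1` [set k] else set0)).
  apply: countable_bigcupT_measurable => // k.
  by case: asboolP => _; [exact: mc|exact: measurable0].
apply/seteqP; split => [w Bfw|w [k _]].
  by exists (c w) => //; case: asboolP => // -[]; exists w.
by case: asboolP => //= -[w' w'k Bfw'] wk; rewrite /preimage/= (cf _ w')// wk.
Qed.

Lemma perm_of_card_fibers (K : finType) (N : nat) (x y : 'I_N -> K) :
  (forall t, #|[pred n | x n == t]| = #|[pred n | y n == t]|) ->
  exists s : {perm 'I_N}, forall n, x n = y (s n).
Proof.
move=> xy.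
have countE (z : 'I_N -> K) t : count_mem t (mktuple z) = #|[pred n | z n == t]|.
  by rewrite count_map cardE size_filter -enumT.
have : perm_eq (mktuple x) (mktuple y).
  by apply/allP => t _ /=; rewrite !countE xy.
move=> /tuple_permP[s xs]; exists s => n.
have := congr1 (fun t => nth (x n) t n) xs.
by rewrite !nth_mktuple tnth_mktuple.
Qed.

Section empirical_measure_determines_permuted_law.
Variables (R : realType) (S : ptopologicalType) (N : nat) (N0 : (0 < N)%N).

Lemma empirical_measureE (x : 'I_N -> S) (A : set (borel S)) :
  empirical_measure R N0 x A =
  (N%:R^-1 * #|[pred n | `[< A (x n) >]]|%:R)%:E.
Proof.
rewrite /empirical_measure/= dirac_averageE card_ord.
by rewrite -natr_sum -sum1_card [in RHS]big_mkcond.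
Qed.

Variables (d : measure_display) (W : measurableType d) (x : W -> 'I_N -> S).
Hypothesis mx : forall A : set (borel S), measurable A ->
  measurable_fun [set: W] (fun w => empirical_measure R N0 (x w) A).

Lemma measurable_card_visits (A : set (borel S)) k : measurable A ->
  measurable [set w | #|[pred n | `[< A (x w n) >]]| = k].
Proof.
move=> mA; rewrite (_ : [set _ | _] = [set: W] `&`
    (fun w => empirical_measure R N0 (x w) A) @^-1` [set (N%:R^-1 * k%:R)%:E]).
  by apply: mx => //; exact: emeasurable_set1.
rewrite setTI; apply/seteqP; split => w; rewrite /preimage/= empirical_measureE.
  by move=> ->.
move=> -[/mulfI kE]; apply/eqP; rewrite -(eqr_nat R); apply/eqP/kE.
by rewrite invr_eq0 pnatr_eq0 -lt0n.
Qed.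

(** The type of a point p is the vector recording which A n contain p. When two
    configurations have the same number of particles of each type, a permutation
    matches the types, and the law of a uniform ordering gives the box the same
    mass for both. The numbers of particles of each type are measurable by
    hypothesis. *)
Lemma measurable_permuted_law_box (A : 'I_N -> set (borel S)) :
  (forall n, measurable (A n)) ->
  measurable_fun [set: W] (fun w => permuted_law R (x w) (box A)).
Proof.
move=> mA.
pose tau (p : S) : {ffun 'I_N -> bool} := [ffun n => `[< A n p >]].
have mtau t : measurable (tau @^-1` [set t] : set (borel S)).
  rewrite (_ : tau @^-1` _ = \bigcap_n (if t n then A n else ~` A n)).
    apply: fin_bigcap_measurable => [|n _]; first exact: finite_finset.
    by case: (t n) => //; exact: measurableC.
  apply/seteqP; split => [p <- n _|p Ap].
    by rewrite ffunE; case: asboolP.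
  apply/ffunP => n; rewrite ffunE; have := Ap n I.
  by case: (t n) => ?; apply/asboolP.
pose c w := [ffun t => #|[pred n | tau (x w n) == t]|].
move=> _ B _; rewrite setTI.
apply: (@measurable_preimage_determined _ _ _ _ c) => [k|w w' /ffunP cww'].
  rewrite (_ : _ @^-1` _ = \bigcap_t
      [set w | #|[pred n | `[< (tau @^-1` [set t]) (x w n) >]]| = k t]).
    apply: fin_bigcap_measurable => [|t _]; first exact: finite_finset.
    exact: measurable_card_visits.
  have cardE w t : #|[pred n | `[< (tau @^-1` [set t]) (x w n) >]]| = c w t.
    rewrite ffunE; apply: eq_card => n; rewrite !inE /preimage/=.
    by apply/asboolP/eqP.
  apply/seteqP; split => [w <- t _ /=|w kw]; first by rewrite cardE.
  by apply/ffunP => t; rewrite -cardE; exact: kw.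
have [r xr] : exists r : {perm 'I_N}, forall n, tau (x w n) = tau (x w' (r n)).
  apply: (perm_of_card_fibers (x := tau \o x w) (y := tau \o x w')) => t.
    by have := cww' t; rewrite !ffunE.
have Ar n m : A n (x w m) <-> A n (x w' (r m)).
  by apply: asbool_eq_equiv; have /ffunP/(_ n) := xr m; rewrite !ffunE.
rewrite -(@permuted_law_perm R S N (fun n => x w' (r n)) (x w') r)//; last first.
  exact: box_measurable.
rewrite /permuted_law/= /dirac_average; congr (_ * _)%E; apply: eq_bigr => s _.
rewrite !diracE; congr ((_ : bool)%:R%:E); apply/idP/idP; rewrite !inE => As n.
  exact/Ar/As.
exact/(Ar n (s n))/As.
Qed.

Lemma measurable_permuted_law
    (A : set (borel (prod_topology (fun _ : 'I_N => S)))) :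
  polish R S -> measurable A ->
  measurable_fun [set: W] (fun w => permuted_law R (x w) A).
Proof.
move=> /polish_pi_base[B baseB _].
have baseBN := @pi_base_boxes _ (fun _ : 'I_N => S) _ (fun=> baseB).
have [_ _ BI _] := baseBN.
apply: (measurable_probability_pi_system (borel_pi_base baseBN) BI).
move=> _ [V BV <-]; apply: measurable_permuted_law_box => n.
by apply: sub_sigma_algebra; apply: (pi_base_open baseB); exact: BV.
Qed.

End empirical_measure_determines_permuted_law.

(** * Almost sure uniqueness of conditional laws *)

Section regular_cond_law_unique.
Context d d1 d2 (Omega : measurableType d) (E : measurableType d1)
  (F : measurableType d2) (R : realType) (P : probability Omega R).
Variables (Y : Omega -> E) (Z : Omega -> F).
Hypothesis mZ : measurable_fun setT Z.
Local Notation OmegaZ := (g_sigma_algebra_preimageType Z).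
Variables K K' : R.-pker OmegaZ ~> E.
Hypotheses (KP : regular_cond_law P Y K) (KP' : regular_cond_law P Y K').

Let forget : Omega -> OmegaZ := id.

Let measurable_forget : measurable_fun setT forget.
Proof.
by move=> _ _ [B mB <-]; apply: measurableI => //; exact: mZ.
Qed.

(** Both sides are functions measurable with respect to Z with the same integral
    over every event of the sigma-algebra of Z. The comparison of integrals is
    made for the restriction of P to that sigma-algebra, where these events are
    all the measurable sets. *)
Lemma regular_cond_law_ae_eq_on (A : set E) : measurable A ->
  {ae P, forall w, K w A = K' w A}.
Proof.
move=> mA.
have @PZ : {measure set OmegaZ -> \bar R}.
  by refine (pushforward P forget); exact: measurable_forget.
suff [N [mN PN0 KN]] : ae_eq PZ setT (K ^~ A) (K' ^~ A).
  exists N; split => //.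
    by rewrite -[X in measurable X]setTI; exact: measurable_forget.
  by move=> w /= Kw; apply: KN => /(_ I).
apply: integral_ae_eq => //.
- apply: (@le_integrable _ _ _ PZ setT measurableT _ (cst 1%E)) => //.
  + exact: measurable_kernel.
  + move=> w _; rewrite /= normr1 gee0_abs//.
    by rewrite -(prob_kernel (s := K) w) le_measure// inE.
  + apply/integrableP; split; first exact: measurable_cst.
    under eq_integral do rewrite /= normr1.
    by rewrite integral_cst// mul1e (probability_setT P : PZ setT = 1%E) ltry.
- exact: measurable_kernel.
- move=> _ _ [B mB <-]; rewrite setTI.
  have mZB : measurable (Z @^-1` B : set OmegaZ) by exists B; rewrite ?setTI.
  have mK (L : R.-pker OmegaZ ~> E) :
      measurable_fun (Z @^-1` B : set OmegaZ) (L ^~ A).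
    by apply: measurable_funTS; exact: measurable_kernel.
  rewrite !ge0_integral_pushforward//.
  exact: etrans (KP mA mB) (esym (KP' mA mB)).
Qed.

Lemma regular_cond_law_ae_eq (G : set (set E)) :
  @measurable _ E = <<s G >> -> setI_closed G -> G setT -> countable G ->
  {ae P, forall w A, measurable A -> K w A = K' w A}.
Proof.
move=> mG GI GT cG.
have [e Ge] := countable_enumeration cG (ex_intro _ _ GT).
have Gmeas A : G A -> measurable A by rewrite mG; exact: sub_sigma_algebra.
have : {ae P, forall w n, K w (e n) = K' w (e n)}.
  apply: ae_foralln => n; apply: regular_cond_law_ae_eq_on.
  by apply: Gmeas; rewrite Ge; exists n.
apply: (@filterS _ _ (ae_filter_ringOfSetsType P)) => w Kw A mA.
apply: (measure_unique G (fun=> setT)) => //.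
- by apply/seteqP; split=> // x _; exists 0%N.
- by move=> V; rewrite Ge => -[n _ <-].
- by move=> _; rewrite prob_kernel ltry.
Qed.

End regular_cond_law_unique.

(** * Shuffling the particles inside each class *)

Section shuffling.
Variables (R : realType) (C : nat) (S : 'I_C -> ptopologicalType).
Variables (N : 'I_C -> nat) (N0 : forall i, (0 < N i)%N).
Hypothesis polishS : forall i, polish R (S i).

Definition shuffles : finType := fprod (fun i : 'I_C => {perm 'I_(N i)}).

Definition shuffle (s : shuffles) (x : borel (configuration S N)) :
    borel (configuration S N) :=
  fun i n => x i (s i n).

Lemma card_shuffles_gt0 : (0 < #|shuffles|)%N.
Proof. by apply/card_gt0P; exists (fprod_of_fun (fun=> 1%g)). Qed.

Definition shuffled_law (x : borel (configuration S N)) :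
    probability (borel (configuration S N)) R :=
  dirac_average R card_shuffles_gt0 (fun s => shuffle s x).

(** A uniform element of a product of groups has independent uniform
    components. *)
Lemma shuffled_law_box (x : borel (configuration S N))
    (A : forall i, set (borel (prod_topology (fun _ : 'I_(N i) => S i)))) :
  shuffled_law x (box A) = (\prod_i permuted_law R (x i) (A i))%E.
Proof.
rewrite /shuffled_law/= dirac_averageE.
under eq_bigr do rewrite /permuted_law/= dirac_averageE.
rewrite -(big_morph EFin (@EFinM R) erefl) big_split/= prod_sum_fprod.
rewrite card_fprod natr_prod -prodfV; congr ((_ * _)%:E); apply: eq_bigr => s _.
rewrite -natr_prod; congr (_%:R).
have [As|As] := pselect (box A (shuffle s x)).
  by rewrite mem_set// big1// => i _; rewrite mem_set//; exact: As.
rewrite memNset//; have /existsNP[i Ai] := As.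
by rewrite (bigD1 i)//= memNset.
Qed.

Definition config_empirical (x : configuration S N) :
    prod_topology (fun i : 'I_C => prob_space R (S i) : ptopologicalType) :=
  fun i => empirical_measure R (N0 i) (x i).

Lemma config_empirical_shuffle s x :
  config_empirical (shuffle s x) = config_empirical x.
Proof.
apply: functional_extensionality_dep => i; apply: eq_probability => A.
rewrite /empirical_measure/= /dirac_average; congr (_ * _)%E.
by rewrite [RHS](reindex_inj (@perm_inj _ (s i))).
Qed.

(** The integral of a bounded continuous f against the empirical measure of x is
    the average of the numbers f (x n), which depends continuously on x. *)
Lemma config_empirical_continuous : continuous config_empirical.
Proof.
(* the target is a product over the classes of initial topologies for maps into
   products over the test functions bc, so each pair (i, bc) is treated apart *)
move=> x; apply/cvg_sup => i.
apply: (@continuous_comp_initial _ _ _ (fun f => f i) config_empirical).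
apply: continuous_comp_initial => y; apply/cvg_sup => bc.
apply: (@continuous_comp_initial _ _ _ (fun z => z bc)) => z.
have [cf _] := svalP bc.
have integralE (w : configuration S N) : integrals (config_empirical w i) bc =
    (N i)%:R^-1 * \sum_n sval bc (w i n).
  rewrite /integrals /config_empirical Rintegral_dirac_average ?card_ord//.
  exact: continuous_measurable_realfun.
rewrite [X in continuous_at _ X](_ : _ = (fun w : configuration S N =>
    (N i)%:R^-1 * \sum_n sval bc (w i n))); last exact/funext/integralE.
apply: cvgM; first exact: cvg_cst.
elim: (index_enum _) => [|n e ih].
  by under eq_fun do rewrite big_nil; rewrite big_nil; exact: cvg_cst.
under eq_fun do rewrite big_cons; rewrite big_cons; apply: cvgD ih.
apply: (@continuous_comp _ _ _ (fun w : configuration S N => w i n) (sval bc)).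
  apply: (@continuous_comp _ _ _ (fun w : configuration S N => w i)
    (fun v : prod_topology (fun _ : 'I_(N i) => S i) => v n)).
    exact: (@coordinate_continuous _
      (fun i => prod_topology (fun _ : 'I_(N i) => S i)) i z).
  exact: (@coordinate_continuous _ (fun _ : 'I_(N i) => S i) n (z i)).
exact: cf.
Qed.

Lemma configuration_pi_base : exists B : forall i, set (set (S i)),
  (forall i, pi_base (B i)) /\
  pi_base (boxes (fun i => boxes (fun _ : 'I_(N i) => B i)) :
    set (set (configuration S N))).
Proof.
have base i : {B : set (set (S i)) | pi_base B}.
  by apply: cid; have [B] := polish_pi_base (polishS i); exists B.
exists (fun i => sval (base i)); split; first by move=> i; exact: svalP (base i).
apply: pi_base_boxes => i; apply: pi_base_boxes => n; exact: svalP (base i).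
Qed.

End shuffling.

Lemma emeasurable_fun_prod d (W : measurableType d) (R : realType) (I : Type)
    (s : seq I) (h : I -> W -> \bar R) :
  (forall i, measurable_fun [set: W] (h i)) ->
  measurable_fun [set: W] (fun w => \prod_(i <- s) h i w)%E.
Proof.
move=> mh; elim: s => [|i s ih].
  by under eq_fun do rewrite big_nil; exact: measurable_cst.
by under eq_fun do rewrite big_cons; exact: emeasurable_funM.
Qed.

Section multiclass_system.
Variables (R : realType) (C : nat) (S : 'I_C -> ptopologicalType).
Variables (N : 'I_C -> nat) (N0 : forall i, (0 < N i)%N).
Hypothesis polishS : forall i, polish R (S i).
Context d (Omega : measurableType d) (P : probability Omega R).

Lemma measurable_system
    (X : forall i : 'I_C, 'I_(N i) -> {RV P >-> borel (S i)}) :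
  measurable_fun [set: Omega] (system X).
Proof.
have [B [baseB baseBB]] := configuration_pi_base N polishS.
apply: (@measurability _ _ Omega (borel (configuration S N)) _ _ _
  (borel_pi_base baseBB)).
move=> _ [_ [V BV <-] <-]; rewrite setTI.
rewrite (_ : _ @^-1` _ = \bigcap_i [set w | V i (fun n => X i n w)]); last first.
  by apply/seteqP; split => w Vw i; [move=> _; exact: Vw|exact: (Vw i I)].
apply: fin_bigcap_measurable => [|i _]; first exact: finite_finset.
have [U BU <-] := BV i.
rewrite (_ : [set _ | _] = \bigcap_n (X i n @^-1` U n)); last first.
  by apply/seteqP; split => w Uw n; [move=> _; exact: Uw|exact: (Uw n I)].
apply: fin_bigcap_measurable => [|n _]; first exact: finite_finset.
apply: measurable_funPTI; apply: sub_sigma_algebra.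
by apply: (pi_base_open (baseB i)); exact: BU.
Qed.

Variable X : forall i : 'I_C, 'I_(N i) -> {RV P >-> borel (S i)}.
Local Notation Z := (empirical_vector X N0).
Local Notation OmegaZ := (g_sigma_algebra_preimageType Z).

Lemma measurable_config_empirical : measurable_fun
  [set: borel (configuration S N)]
  (config_empirical R N0 : borel (configuration S N) ->
    borel (prod_topology
      (fun i : 'I_C => prob_space R (S i) : ptopologicalType))).
Proof. by apply: continuous_borel; exact: config_empirical_continuous. Qed.

Lemma measurable_empirical_vector : measurable_fun [set: Omega] Z.
Proof.
exact: measurableT_comp measurable_config_empirical (measurable_system X).
Qed.

(** On a box the mass is a finite product of masses of uniform orderings, each
    depending on one component of Z only. *)
Lemma measurable_shuffled_law (A : set (borel (configuration S N))) :
  measurable A ->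
  measurable_fun [set: OmegaZ] (fun w => shuffled_law R (system X w) A).
Proof.
have [B [baseB baseBB]] := configuration_pi_base N polishS.
have [_ _ BI _] := baseBB.
apply: (measurable_probability_pi_system (borel_pi_base baseBB) BI).
move=> _ [V BV <-].
have -> : (fun w : OmegaZ => shuffled_law R (system X w) (box V)) =
    (fun w : OmegaZ =>
      (\prod_i permuted_law R (fun n => X (i := i) n w) (V i))%E).
  by apply/funext => w; exact: shuffled_law_box.
apply: emeasurable_fun_prod => i.
apply: (@measurable_permuted_law R (S i) (N i) (N0 i)) => //.
  move=> U mU.
  have mcoord := continuous_borel
    (@coordinate_continuous _ (fun i => prob_space R (S i)) i).
  have mZ : measurable_fun [set: OmegaZ] Z by move=> _ D mD; exists D.
  exact: (measurableT_comp (measurable_evaluation (polishS i) mU)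
    (measurableT_comp mcoord mZ)).
apply: sub_sigma_algebra.
have [U BU <-] := BV i; apply: box_open => n.
by apply: (pi_base_open (baseB i)); exact: BU.
Qed.

End multiclass_system.

(** * The conditional law given the empirical measures *)

(** The sigma-algebra of the space of probability measures used for kernels is
    generated by the evaluations. *)
Lemma measurable_pprobability d d' (W : measurableType d) (T : measurableType d')
    (R : realType) (m : W -> pprobability T R) :
  (forall A, measurable A -> measurable_fun [set: W] (fun w => m w A)) ->
  measurable_fun [set: W] m.
Proof.
move=> mm.
apply: (@measurability _ _ W (pprobability T R) setT m (@pset _ T R)) => //.
move=> _ [_ [r _ [A mA <-]] <-].
rewrite (_ : m @^-1` _ = (fun w => m w A) @^-1` [set` `]-oo, r%:E[]).
  by apply: mm => //; exact: emeasurable_itv.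
by apply/seteqP; split => w; rewrite /preimage/= in_itv.
Qed.

Section shuffled_law_conditional.
Variables (R : realType) (C : nat) (S : 'I_C -> ptopologicalType).
Variables (N : 'I_C -> nat) (N0 : forall i, (0 < N i)%N).
Hypothesis polishS : forall i, polish R (S i).
Context d (Omega : measurableType d) (P : probability Omega R).
Variable X : forall i : 'I_C, 'I_(N i) -> {RV P >-> borel (S i)}.
Local Notation Z := (empirical_vector X N0).
Local Notation OmegaZ := (g_sigma_algebra_preimageType Z).
Hypothesis exchX : multi_exchangeable X.

Lemma measurable_shuffle (s : shuffles N) :
  measurable_fun [set: Omega] (fun w => shuffle s (system X w)).
Proof. exact: (measurable_system polishS (fun i n => X (s i n))). Qed.

(** Exchangeability, applied to the system lying in A and having its empirical
    measures in B: shuffling does not affect the second condition. *)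
Lemma shuffle_exchangeable (s : shuffles N) (A : set (borel (configuration S N)))
    (B : set (borel (prod_topology
      (fun i : 'I_C => prob_space R (S i) : ptopologicalType)))) :
  measurable A -> measurable B ->
  P ((fun w => shuffle s (system X w)) @^-1` A `&` Z @^-1` B) =
  P (system X @^-1` A `&` Z @^-1` B).
Proof.
move=> mA mB.
have mPhiB : measurable
    (config_empirical R N0 @^-1` B : set (borel (configuration S N))).
  by rewrite -[X in measurable X]setTI; apply: measurable_config_empirical.
have ZE : (fun w => shuffle s (system X w)) @^-1`
    (config_empirical R N0 @^-1` B) = Z @^-1` B.
  by apply/funext => w; rewrite /preimage/= config_empirical_shuffle.
rewrite -[in LHS]ZE.
exact: exchX (fun i => s i) _ (measurableI _ _ mA mPhiB).
Qed.

(** Integrating the average over s gives the average of the probabilities of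
    [shuffle_exchangeable], which are all equal. *)
Lemma shuffled_law_conditional (A : set (borel (configuration S N)))
    (B : set (borel (prod_topology
      (fun i : 'I_C => prob_space R (S i) : ptopologicalType)))) :
  measurable A -> measurable B ->
  (\int[P]_(w in Z @^-1` B) shuffled_law R (system X w) A)%E =
  P (system X @^-1` A `&` Z @^-1` B).
Proof.
move=> mA mB; have G0 := card_shuffles_gt0 N.
have mZB : measurable (Z @^-1` B).
  by rewrite -[X in measurable X]setTI; apply: measurable_empirical_vector.
have msA s : measurable ((fun w => shuffle s (system X w)) @^-1` A).
  by rewrite -[X in measurable X]setTI; apply: measurable_shuffle.
pose sA s := (fun w => shuffle s (system X w)) @^-1` A.
have mind s : measurable_fun (Z @^-1` B) (fun w => (\1_(sA s) w)%:E : \bar R).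
  by apply/measurable_EFinP; apply: measurable_indic; exact: msA.
rewrite (eq_integral (fun w => (#|shuffles N|%:R^-1)%:E *
    \sum_(s : shuffles N) (\1_(sA s) w)%:E)%E); last first.
  by move=> w _; congr (_ * _)%E; apply: eq_bigr => s _; rewrite diracE indicE.
rewrite ge0_integralZl//; last 2 first.
- exact: emeasurable_sum.
- by move=> w _; apply: sume_ge0 => s _; rewrite lee_fin.
rewrite ge0_integral_sum//.
rewrite (eq_bigr (fun=> P (system X @^-1` A `&` Z @^-1` B))); last first.
  move=> s _; rewrite integral_indic//; last exact: msA.
  exact: shuffle_exchangeable.
have mAB : measurable (system X @^-1` A `&` Z @^-1` B).
  apply: measurableI => //.
  by rewrite -[X in measurable X]setTI; exact: measurable_system.
have [r ->] : exists r, P (system X @^-1` A `&` Z @^-1` B) = r%:E.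
  exists (fine (P (system X @^-1` A `&` Z @^-1` B))).
  by rewrite fineK ?fin_num_measure.
rewrite sumEFin sumr_const -EFinM.
by rewrite -[r *+ _]mulr_natl mulKf// pnatr_eq0 -lt0n.
Qed.

Lemma regular_cond_law_shuffled :
  exists2 K : R.-pker OmegaZ ~> borel (configuration S N),
    regular_cond_law P (system X) K &
    forall w, K w = shuffled_law R (system X w) :> (set _ -> \bar R).
Proof.
pose K0 (w : OmegaZ) : pprobability (borel (configuration S N)) R :=
  shuffled_law R (system X w).
have mK0 : measurable_fun [set: OmegaZ] K0.
  by apply: measurable_pprobability => A; exact: measurable_shuffled_law.
exists (kprobability mK0) => // A B mA mB; exact: shuffled_law_conditional.
Qed.

Lemma shuffled_law_is_product_law w :
  is_product_law (fun i => uniform_ordering (N0 i) (Z w i))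
    (shuffled_law R (system X w)).
Proof.
move=> A mA; rewrite [LHS]shuffled_law_box; apply: eq_bigr => i _.
apply/esym/(uniform_ordering_empirical_measure (polish_hausdorff (polishS i))).
  by [].
exact: mA.
Qed.

End shuffled_law_conditional.

Theorem theorem3p1 (R : realType) (C : nat) (C0 : (0 < C)%N)
  (S : 'I_C -> ptopologicalType) (polishS : forall i, polish R (S i))
  (N : 'I_C -> nat) (N0 : forall i, (0 < N i)%N)
  (d : measure_display) (Omega : measurableType d) (P : probability Omega R)
  (X : forall i : 'I_C, 'I_(N i) -> {RV P >-> borel (S i)})
  (exchX : multi_exchangeable X) :
  (exists K : R.-pker (g_sigma_algebra_preimageType (empirical_vector X N0)) ~>
                borel (configuration S N),
     regular_cond_law P (system X) K) /\
  (forall K : R.-pker (g_sigma_algebra_preimageType (empirical_vector X N0)) ~>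
                borel (configuration S N),
     regular_cond_law P (system X) K ->
     {ae P, forall w,
        is_product_law
          (fun i => uniform_ordering (N0 i) (empirical_vector X N0 w i))
          (K w)}).
Proof.
have [K0 K0P K0E] := regular_cond_law_shuffled N0 polishS exchX.
split=> [|K KP]; first by exists K0.
have [B [_ baseBB]] := configuration_pi_base N polishS.
have [cB BT BI _] := baseBB.
have := regular_cond_law_ae_eq (measurable_empirical_vector N0 polishS X) KP K0P
  (borel_pi_base baseBB) BI BT cB.
apply: (@filterS _ _ (ae_filter_ringOfSetsType P)) => w KK0 A mA.
rewrite KK0 ?K0E; first exact: shuffled_law_is_product_law.
exact: box_measurable.
Qed.
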